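(* Let $\Phi=\langle x,\gamma\rangle\le W$ be the Fabrykowski–Gupta group, with $x$ the rigid $3$-cycle and $\gamma=(\gamma,x,1)$. Let $U=\langle\Delta^n(x):n\ge1\rangle$, a countably infinite elementary abelian $3$-group. Then $\mathrm{Aut}(\Phi)=\Phi:U$ (a split extension).
   Context: $W$ is the isometry group of the ternary tree $X^*$, $X=\{0,1,2\}$; elements are written $(g_0,g_1,g_2)\pi$, meaning $(yw)^{(g_0,g_1,g_2)\pi}=y^\pi w^{g_y}$. $x=(1,1,1)(0\,1\,2)$. $\Delta g=(g,g,g)$ and $\Delta^n$ its iterate. $\mathrm{Aut}(\Phi)$ is realized inside $W$ as the normalizer of $\Phi$ in $W$, acting by conjugation. *)

(* Defs.v *)
(* The ternary tree X^* with X = {0,1,2} is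
   modelled by words [seq 'I_3]; elements of W act on the RIGHT, so a
   function f : word -> word represents g via  w^g = f w, and the product
   g h ("first g, then h") is the function  fun w => h (g w). *)
From mathcomp Require Import all_boot.
Set Implicit Arguments. Unset Strict Implicit. Unset Printing Implicit Defensive.

Definition word := seq 'I_3.
Definition tfun := word -> word.

Definition isometry (f : tfun) : Prop :=
  bijective f /\ (forall w, size (f w) = size w) /\
  (forall (w : word) (n : nat), f (take n w) = take n (f w)).

Definition tmul (g h : tfun) : tfun := fun w => h (g w).
Definition tid : tfun := fun w => w.

Definition xf : tfun := fun w =>
  match w with [::] => [::] | y :: w' => ordS y :: w' end.

Fixpoint gammaf (w : word) : word :=
  match w with
  | [::] => [::]
  | y :: w' =>
      if val y == 0 then y :: gammaf w'
      else if val y == 1 then y :: xf w'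
      else y :: w'
  end.

Definition Delta (g : tfun) : tfun := fun w =>
  match w with [::] => [::] | y :: w' => y :: g w' end.

Inductive gen (S : tfun -> Prop) : tfun -> Prop :=
  | gen_id : gen S tid
  | gen_mul s g : S s -> gen S g -> gen S (tmul s g)
  | gen_inv s s' g : S s -> cancel s s' -> cancel s' s -> gen S g ->
      gen S (tmul s' g).

Definition Phi : tfun -> Prop := gen (fun s => s = xf \/ s = gammaf).

Definition U : tfun -> Prop :=
  gen (fun s => exists n, 1 <= n /\ s = iter n Delta xf).

Definition normalizes (H : tfun -> Prop) (f : tfun) : Prop :=
  isometry f /\ exists finv : tfun, cancel f finv /\ cancel finv f /\
    forall h : tfun,
      (H h -> H (tmul (tmul finv h) f)) /\ (H h -> H (tmul (tmul f h) finv)).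

(* Main.v *)
(* Modulo Phi every f in the normalizer N satisfies f = Delta(f_y) Delta(x)^k for
   each first-level section f_y, and f_y is again in N; this rests on Phi being
   branch over its commutator subgroup, which reduces membership in Phi to
   linear conditions modulo 3 on the sections. So f lies in Phi U as soon as some
   section does, and a descent shows that one does. For f fixing the first level,
   gamma^f = (gamma^{f_0}, x^{f_1}, 1), so passing to f_0 shortens gamma^f unless
   gamma^f = gamma. In the latter case f_0 centralises gamma and f_0 phi = f_1
   centralises x for some phi in Phi; passing to sections again shortens phi,
   until one automorphism centralises both generators and is therefore trivial. *)
Require Import Defs.
From HB Require Import structures.
From mathcomp Require Import all_boot.
From mathcomp Require Import ssralg zmodp.
From mathcomp Require Import boolp.
Set Implicit Arguments. Unset Strict Implicit. Unset Printing Implicit Defensive.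

Import GRing.Theory.
Local Open Scope group_scope.

(** * The isometry group of the tree as a group of bundled maps *)

Record aut := Aut {
  aut_fun :> word -> word;
  aut_inv : word -> word;
  aut_funK : cancel aut_fun aut_inv;
  aut_invK : cancel aut_inv aut_fun;
  aut_size : forall w, size (aut_fun w) = size w;
  aut_take : forall w n, aut_fun (take n w) = take n (aut_fun w) }.

Lemma aut_ext (g h : aut) : aut_fun g =1 aut_fun h -> g = h.
Proof.
case: g h => [f f' fK f'K sf tf] [g g' gK g'K sg tg] /= /funext E.
have E' : f' = g' by apply: funext => w; apply: (can_inj gK); rewrite g'K -E f'K.
by subst; congr Aut; exact: Prop_irrelevance.
Qed.

HB.instance Definition _ := gen_eqMixin aut.
HB.instance Definition _ := gen_choiceMixin aut.

Lemma aut_isometry (g : aut) : isometry (aut_fun g).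
Proof.
split; first by exists (aut_inv g); [exact: aut_funK | exact: aut_invK].
by split; [exact: aut_size | exact: aut_take].
Qed.

Lemma aut_inv_size (g : aut) w : size (aut_inv g w) = size w.
Proof. by rewrite -{2}(aut_invK g w) aut_size. Qed.

Lemma aut_inv_take (g : aut) w n : aut_inv g (take n w) = take n (aut_inv g w).
Proof. by apply: (can_inj (aut_funK g)); rewrite aut_invK aut_take aut_invK. Qed.

Definition aut1 : aut :=
  @Aut tid tid (fun=> erefl) (fun=> erefl) (fun=> erefl) (fun _ _ => erefl).

Definition autV (g : aut) : aut :=
  Aut (aut_invK g) (aut_funK g) (aut_inv_size g) (aut_inv_take g).

Section Product.
Variables g h : aut.
Let m w := h (g w).
Let m' w := aut_inv g (aut_inv h w).
Fact autM_funK : cancel m m'. Proof. by move=> w; rewrite /m /m' !aut_funK. Qed.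
Fact autM_invK : cancel m' m. Proof. by move=> w; rewrite /m /m' !aut_invK. Qed.
Fact autM_size w : size (m w) = size w. Proof. by rewrite !aut_size. Qed.
Fact autM_take w n : m (take n w) = take n (m w).
Proof. by rewrite /m !aut_take. Qed.
Definition autM := Aut autM_funK autM_invK autM_size autM_take.
End Product.

Fact autA : associative autM. Proof. by move=> f g h; apply: aut_ext. Qed.
Fact aut1M : left_id aut1 autM. Proof. by move=> f; apply: aut_ext. Qed.
Fact autM1 : right_id aut1 autM. Proof. by move=> f; apply: aut_ext. Qed.
Fact autVM : left_inverse aut1 autV autM.
Proof. by move=> f; apply: aut_ext => w; exact: aut_invK. Qed.
Fact autMV : right_inverse aut1 autV autM.
Proof. by move=> f; apply: aut_ext => w; exact: aut_funK. Qed.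

HB.instance Definition _ := isGroup.Build aut autA aut1M autM1 autVM autMV.

Lemma autME (g h : aut) w : (g * h) w = h (g w). Proof. by []. Qed.

(** * Root permutations and first-level sections *)

(* In the notation (g_0, g_1, g_2)pi, [rt g] is pi and [sec g y] is g_y. *)
Definition rt (g : aut) (y : 'I_3) : 'I_3 := head y (g [:: y]).

Definition sec_fun (g : aut) y : tfun := fun w => behead (g (y :: w)).

(** Preservation of prefixes, used at length one, makes the first letter of the image depend on [y]
    alone. *)
Lemma autE g y w : aut_fun g (y :: w) = rt g y :: sec_fun g y w.
Proof.
rewrite /rt /sec_fun; have := aut_take g (y :: w) 1; have := aut_size g (y :: w).
by rewrite /= take0; case: (aut_fun g (y :: w)) => //= z v _; rewrite take0 => ->.
Qed.

Lemma aut0 (g : aut) : aut_fun g [::] = [::].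
Proof. by apply: size0nil; rewrite aut_size. Qed.

Lemma rtM g h y : rt (g * h) y = rt h (rt g y).
Proof. by rewrite /rt autME [g [:: y]]autE (autE h) /= [in RHS]autE. Qed.

Lemma rtK g : cancel (rt g) (rt g^-1).
Proof. by move=> y; rewrite -rtM mulgV. Qed.

Lemma rtVK g : cancel (rt g^-1) (rt g).
Proof. by move=> y; rewrite -rtM mulVg. Qed.

Section FirstLevelSection.
Variables (g : aut) (y : 'I_3).
Fact sec_funK : cancel (sec_fun g y) (sec_fun g^-1 (rt g y)).
Proof. by move=> w; rewrite {1}/sec_fun -autE -[g^-1 _]/(aut_inv g _) aut_funK. Qed.
Fact sec_invK : cancel (sec_fun g^-1 (rt g y)) (sec_fun g y).
Proof.
move=> w; have := autE g^-1 (rt g y) w; rewrite rtK => E.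
by rewrite {1}/sec_fun -E aut_invK.
Qed.
Fact sec_size w : size (sec_fun g y w) = size w.
Proof. by rewrite size_behead aut_size. Qed.
Fact sec_take w n : sec_fun g y (take n w) = take n (sec_fun g y w).
Proof. by rewrite /sec_fun -[y :: _]/(take n.+1 (y :: w)) aut_take autE. Qed.
Definition sec := Aut sec_funK sec_invK sec_size sec_take.
End FirstLevelSection.

Lemma aut_cons g y w : aut_fun g (y :: w) = rt g y :: sec g y w.
Proof. exact: autE. Qed.

Lemma aut_eqP g h : rt g =1 rt h -> sec g =1 sec h -> g = h.
Proof.
move=> Er Es; apply: aut_ext => -[|y w]; first by rewrite !aut0.
by rewrite !aut_cons Er Es.
Qed.

Lemma secM g h y : sec (g * h) y = sec g y * sec h (rt g y).
Proof.
by apply: aut_ext => w; rewrite autME /= /sec_fun autME (autE g) (autE h).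
Qed.

Lemma sec1 y : sec 1 y = 1. Proof. exact: aut_ext. Qed.

Lemma secV g y : sec g^-1 (rt g y) = (sec g y)^-1.
Proof. by apply/esym/mulg1_eq; rewrite -secM mulgV sec1. Qed.

Lemma rtJ g f z : rt (g ^ f) (rt f z) = rt f (rt g z).
Proof. by rewrite !rtM rtK. Qed.

Lemma secJ g f z :
  sec (g ^ f) (rt f z) = (sec f z)^-1 * (sec g z * sec f (rt g z)).
Proof. by rewrite !secM secV rtK. Qed.

(** * Diagonal elements and the powers of x and gamma *)

Section Diagonal.
Variable g : 'I_3 -> aut.
Let d w := if w is y :: v then y :: g y v else [::].
Let d' w := if w is y :: v then y :: aut_inv (g y) v else [::].
Fact diag_funK : cancel d d'. Proof. by case=> //= y w; rewrite aut_funK. Qed.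
Fact diag_invK : cancel d' d. Proof. by case=> //= y w; rewrite aut_invK. Qed.
Fact diag_size w : size (d w) = size w.
Proof. by case: w => //= y w; rewrite aut_size. Qed.
Fact diag_take w n : d (take n w) = take n (d w).
Proof. by case: w n => [|y w] [|n] //=; rewrite aut_take. Qed.
Definition diag := Aut diag_funK diag_invK diag_size diag_take.
Lemma rt_diag y : rt diag y = y. Proof. by []. Qed.
Lemma sec_diag y : sec diag y = g y. Proof. exact: aut_ext. Qed.
End Diagonal.

Definition delta g := diag (fun=> g).

Lemma deltaE g : aut_fun (delta g) = Delta g.
Proof. by apply: funext; case. Qed.

Lemma deltaM g h : delta (g * h) = delta g * delta h.
Proof.
by apply: aut_eqP => y; rewrite ?rtM ?secM !(rt_diag, sec_diag).
Qed.

Lemma delta1 : delta 1 = 1.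
Proof. by apply: aut_eqP => y; rewrite ?sec_diag ?sec1. Qed.

Lemma deltaV g : delta g^-1 = (delta g)^-1.
Proof. by apply/esym/mulg1_eq; rewrite -deltaM mulgV delta1. Qed.

Lemma delta_inj : injective delta.
Proof.
by move=> g h E; rewrite -(sec_diag (fun=> g) ord0) -/(delta g) E sec_diag.
Qed.

Lemma I3P (y : 'I_3) : [\/ y = 0%R, y = 1%R | y = 2%R].
Proof.
case: y => -[|[|[|//]]] H; [apply: Or31|apply: Or32|apply: Or33]; exact: val_inj.
Qed.

Section Rotation.
Variable k : 'I_3.
Let r l (w : word) := if w is y :: v then (y + l)%R :: v else [::].
Fact xp_funK : cancel (r k) (r (- k)%R).
Proof. by case=> //= y w; rewrite addrK. Qed.
Fact xp_invK : cancel (r (- k)%R) (r k).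
Proof. by case=> //= y w; rewrite subrK. Qed.
Fact xp_size w : size (r k w) = size w. Proof. by case: w. Qed.
Fact xp_take w n : r k (take n w) = take n (r k w).
Proof. by case: w n => [|y w] [|n]. Qed.
Definition xp := Aut xp_funK xp_invK xp_size xp_take.
Lemma rt_xp y : rt xp y = (y + k)%R. Proof. by []. Qed.
Lemma sec_xp y : sec xp y = 1. Proof. exact: aut_ext. Qed.
End Rotation.

Arguments xp k%_R.
Arguments sec g y%_R.
Arguments rt g y%_R.

Lemma xpD k l : xp (k + l) = xp k * xp l.
Proof.
by apply: aut_eqP => y; rewrite ?rtM ?secM !(rt_xp, sec_xp) ?addrA ?mulg1.
Qed.

Lemma xp0 : xp 0 = 1.
Proof. by apply: aut_eqP => y; rewrite ?(rt_xp, sec_xp) ?addr0 ?sec1. Qed.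

Lemma xpN k : xp (- k) = (xp k)^-1.
Proof. by apply/esym/mulg1_eq; rewrite -xpD subrr xp0. Qed.

Lemma xpC k l : xp k * xp l = xp l * xp k.
Proof. by rewrite -!xpD addrC. Qed.

Lemma xp1E : aut_fun (xp 1) = xf.
Proof.
apply: funext; case=> //= y w; congr (_ :: _); apply: val_inj => /=.
by rewrite addn1.
Qed.

(* The powers of gamma; unfolding gamma = (gamma, x, 1) with the exponent as
   a parameter makes additivity in [e : Z/3] immediate. *)
Fixpoint gp_fun (e : 'I_3) (w : word) : word :=
  if w is y :: v then
    y :: (if y == 0%R then gp_fun e v else if y == 1%R then xp e v else v)
  else [::].

Fact gp_funK e : cancel (gp_fun e) (gp_fun (- e)%R).
Proof.
elim=> //= y w IH; case: (y == 0%R); first by rewrite IH.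
case: (y == 1%R) => //; congr (_ :: _).
exact: (aut_funK (xp e) w).
Qed.
Fact gp_invK e : cancel (gp_fun (- e)%R) (gp_fun e).
Proof. by move=> w; rewrite -{1}(opprK e) gp_funK. Qed.
Fact gp_size e w : size (gp_fun e w) = size w.
Proof.
elim: w => //= y w IH; case: (y == 0%R); first by rewrite IH.
by case: (y == 1%R) => //; rewrite -[in RHS](aut_size (xp e)).
Qed.
Fact gp_take e w n : gp_fun e (take n w) = take n (gp_fun e w).
Proof.
elim: w n => [|y w IH] [|n] //=; case: (y == 0%R); first by rewrite IH.
by case: (y == 1%R) => //; congr (_ :: _); exact: (aut_take (xp e)).
Qed.
Definition gp e := Aut (@gp_funK e) (@gp_invK e) (@gp_size e) (@gp_take e).

Arguments gp e%_R.

Lemma rt_gp e y : rt (gp e) y = y. Proof. by []. Qed.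

Lemma sec_gp e y :
  sec (gp e) y = if y == 0%R then gp e else if y == 1%R then xp e else 1.
Proof.
apply: aut_ext => w; rewrite /= /sec_fun /=.
by case: (y == 0%R) => //; case: (y == 1%R).
Qed.

Lemma gpD e f : gp (e + f) = gp e * gp f.
Proof.
apply: aut_ext; elim=> [|y w IH] //.
rewrite autME !aut_cons !rt_gp !sec_gp; congr (_ :: _).
case: (y == 0%R) => //.
by case: (y == 1%R) => //; rewrite xpD.
Qed.

Lemma gp0 : gp 0 = 1.
Proof. by apply: (mulgI (gp 0)); rewrite -gpD addr0 mulg1. Qed.

Lemma gpN k : gp (- k) = (gp k)^-1.
Proof. by apply/esym/mulg1_eq; rewrite -gpD subrr gp0. Qed.

Lemma gp1E : aut_fun (gp 1) = gammaf.
Proof.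
apply: funext; elim=> //= y w ->; rewrite -xp1E.
by case: (I3P y) => ->.
Qed.

Lemma xp_inj : injective xp.
Proof. by move=> k l E; have := rt_xp k 0%R; rewrite E rt_xp !add0r. Qed.
Lemma gp_inj : injective gp.
Proof.
by move=> k l E; have := sec_gp k 1%R; rewrite E sec_gp /= => /xp_inj.
Qed.

(* The conjugate of gamma^e by x^i, as (1,..,gamma^e,x^e,..) with gamma^e in
   position i, where the pair is [p = (i, e)]. *)
Definition gconj (p : 'I_3 * 'I_3) : aut :=
  diag (fun y =>
    if y == p.1 then gp p.2 else if y == (p.1 + 1)%R then xp p.2 else 1).

Lemma rt_gconj p y : rt (gconj p) y = y. Proof. by []. Qed.

Lemma sec_gconj p y :
  sec (gconj p) y =
    if y == p.1 then gp p.2 else if y == (p.1 + 1)%R then xp p.2 else 1.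
Proof. exact: sec_diag. Qed.

Lemma gconjE p : gconj p = gp p.2 ^ xp p.1.
Proof.
apply: aut_eqP => y; first by rewrite !rtM rt_gp rtVK.
have := secJ (gp p.2) (xp p.1) (y - p.1)%R.
rewrite rt_xp subrK rt_gp !sec_xp invg1 mulg1 mul1g sec_gp => ->.
by rewrite sec_gconj subr_eq0 subr_eq [(1 + _)%R]addrC.
Qed.

(** * Words in the conjugates of gamma, and length in Phi *)

Definition gword (s : seq ('I_3 * 'I_3)) : aut := \prod_(p <- s) gconj p.

Lemma gword_nil : gword [::] = 1.
Proof. exact: big_nil. Qed.

Lemma gword_cons p s : gword (p :: s) = gconj p * gword s.
Proof. exact: big_cons. Qed.

Lemma gword_cat s t : gword (s ++ t) = gword s * gword t.
Proof. exact: big_cat. Qed.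

Lemma gwordJ s k : gword s ^ xp k = gword [seq (p.1 + k, p.2)%R | p <- s].
Proof.
rewrite conjg_prod /gword big_map; apply: eq_bigr => p _.
by rewrite !gconjE -conjgM -xpD.
Qed.

Lemma gwordV s : (gword s)^-1 = gword (rev [seq (p.1, - p.2)%R | p <- s]).
Proof.
elim: s => [|p s IH]; first by rewrite !gword_nil invg1.
rewrite gword_cons invgM IH /= rev_cons -cats1 gword_cat; congr (_ * _).
by rewrite /gword big_seq1 !gconjE /= gpN conjVg.
Qed.

(* Every element of Phi is a product of conjugates of powers of gamma times a
   power of x; [len n g] bounds by [n] the number of gamma-letters. *)
Definition len n g := exists s k, size s <= n /\ g = gword s * xp k.

Lemma len_xp k : len 0 (xp k).
Proof. by exists [::], k; rewrite gword_nil mul1g. Qed.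

Lemma len_gconj p : len 1 (gconj p).
Proof. by exists [:: p], 0%R; rewrite /gword big_seq1 xp0 mulg1. Qed.

Lemma len_gp e : len 1 (gp e).
Proof. by have := len_gconj (0, e)%R; rewrite !gconjE xp0 conjg1. Qed.

Lemma len1 : len 0 1. Proof. by rewrite -xp0; exact: len_xp. Qed.

(** Moving [xp k] past a word conjugates its letters, which only shifts their positions and creates
    no new gamma-letter. *)
Lemma lenM m n g h : len m g -> len n h -> len (m + n) (g * h).
Proof.
move=> [s [k [le_s ->]]] [t [l [le_t ->]]].
exists (s ++ [seq (p.1 - k, p.2)%R | p <- t]), (k + l)%R.
rewrite size_cat size_map leq_add // gword_cat -gwordJ xpN xpD conjgE invgK.
by rewrite !mulgA !mulgVK.
Qed.

Lemma lenV n g : len n g -> len n g^-1.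
Proof.
move=> [s [k [le_s ->]]]; rewrite invgM gwordV.
set t := rev _; exists [seq (p.1 + k, p.2)%R | p <- t], (- k)%R.
rewrite size_map size_rev size_map; split=> //.
by rewrite -gwordJ xpN conjgE -!mulgA mulgV mulg1.
Qed.

Lemma lenJ n g k : len n g -> len n (g ^ xp k).
Proof.
move=> Lg; rewrite conjgE -xpN -[n]add0n -[n]addn0.
by apply: lenM (len_xp _) (lenM _ (len_xp _)).
Qed.

Definition phi : {pred aut} := fun g => `[< exists n, len n g >].

Lemma phiP g : reflect (exists n, len n g) (g \in phi).
Proof. exact: asboolP. Qed.

Fact phi_one : 1 \in phi. Proof. by apply/phiP; exists 0; exact: len1. Qed.
Fact phi_mul : mulg_closed phi.
Proof.
by move=> g h /phiP[m Lg] /phiP[n Lh]; apply/phiP; exists (m + n); exact: lenM.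
Qed.
Fact phi_inv : invg_closed phi.
Proof. by move=> g /phiP[n Lg]; apply/phiP; exists n; exact: lenV. Qed.
HB.instance Definition _ := isMulClosed.Build aut phi phi_mul.
HB.instance Definition _ := isMul1Closed.Build aut phi phi_one.
HB.instance Definition _ := isInvClosed.Build aut phi phi_inv.

Lemma len_phi n g : len n g -> g \in phi.
Proof. by move=> Lg; apply/phiP; exists n. Qed.

Lemma phi_xp k : xp k \in phi. Proof. exact: len_phi (len_xp k). Qed.
Lemma phi_gp e : gp e \in phi. Proof. exact: len_phi (len_gp e). Qed.
Lemma phi_gconj p : gconj p \in phi. Proof. exact: len_phi (len_gconj p). Qed.

Lemma phi_ind (P : aut -> Prop) :
    (forall k, P (xp k)) -> (forall e, P (gp e)) ->
    (forall g h, g \in phi -> h \in phi -> P g -> P h -> P (g * h)) ->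
  forall g, g \in phi -> P g.
Proof.
move=> Px Pg PM g /phiP[_ [s [k [_ ->]]]].
elim: s => [|p s IH]; first by rewrite gword_nil mul1g.
rewrite gword_cons -mulgA; apply: (PM) => //; first exact: phi_gconj.
  by apply: len_phi; exists s, k.
rewrite !gconjE conjgE -xpN; apply: (PM) => //;
  rewrite ?phi_xp // ?gpredM ?phi_xp ?phi_gp //.
by apply: (PM); rewrite ?phi_xp ?phi_gp.
Qed.

(** A letter at position i contributes a gamma-letter only to section i; in section i+1 it leaves a
    power of x, which has length 0. The lengths of the three sections thus share out the length of
    [s]; both descents rest on this. *)
Lemma len_sec_gword s y : len (count (fun p => p.1 == y) s) (sec (gword s) y).
Proof.
elim: s => [|p s IH]; first by rewrite gword_nil sec1; exact: len1.
rewrite gword_cons secM rt_gconj /=; apply: lenM => //.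
rewrite sec_gconj eq_sym; case: eqP => _; first exact: len_gp.
by case: ifP => _; [exact: len_xp | exact: len1].
Qed.

Lemma gword_const s y : all (fun p => p.1 == y) s -> exists e, gword s = gconj (y, e).
Proof.
elim: s => [|[i e] s IH] /=; first by exists 0%R; rewrite !gconjE gp0 conj1g gword_nil.
case/andP=> /eqP-> /IH[f E]; exists (e + f)%R.
by rewrite gword_cons E !gconjE /= gpD conjMg.
Qed.

(** Only letters at position 2 put a power of x into section 0, since 2 + 1 = 0. *)
Lemma sec0_gword s : all (fun p => p.1 != 2%R) s -> exists e, sec (gword s) 0 = gp e.
Proof.
elim: s => [|[i e] s IH] /=; first by exists 0%R; rewrite gword_nil sec1 gp0.
case/andP=> ni /IH[f E]; rewrite gword_cons secM rt_gconj E sec_gconj /=.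
case: (I3P i) ni => -> //= _; first by exists (e + f)%R; rewrite gpD.
by exists f; rewrite mul1g.
Qed.

(** * Exponents modulo 3 and the relation between sections *)

(* On Phi, [e0] and [e1] are the exponents of x and gamma in the
   abelianisation; they are read off the rotations on the first two levels. *)
Definition e0 g : 'I_3 := rt g 0.
Definition e1 g : 'I_3 := (\sum_y e0 (sec g y))%R.
Definition rot g := forall y, rt g y = (y + e0 g)%R.

Lemma e0M g h : rot h -> e0 (g * h) = (e0 g + e0 h)%R.
Proof. by move=> Rh; rewrite {1}/e0 rtM Rh. Qed.

Lemma rotM g h : rot g -> rot h -> rot (g * h).
Proof. by move=> Rg Rh y; rewrite rtM Rg Rh e0M // addrA. Qed.

Lemma rot_rtV g y : rot g -> rt g^-1 y = (y - e0 g)%R.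
Proof. by move=> Rg; apply: (can_inj (rtK g)); rewrite rtVK Rg subrK. Qed.

Lemma e0V g : rot g -> e0 g^-1 = (- e0 g)%R.
Proof. by move=> Rg; rewrite /e0 rot_rtV // add0r. Qed.

Lemma rotV g : rot g -> rot g^-1.
Proof. by move=> Rg y; rewrite e0V // rot_rtV. Qed.

Lemma rot_xp k : rot (xp k). Proof. by move=> y; rewrite /e0 !rt_xp add0r. Qed.
Lemma rot_id g : rt g =1 id -> rot g.
Proof. by move=> E y; rewrite /e0 !E addr0. Qed.
Lemma rot_succ f : (forall y, rt f (y + 1) = (rt f y + 1)%R) -> rot f.
Proof.
move=> S y; have E1 := S 0%R; have E2 := S 1%R.
rewrite add0r in E1; case: (I3P y) => ->; first by rewrite add0r.
  by rewrite E1 addrC.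
by rewrite -[rt f 2]/(rt f (1 + 1)) E2 E1 -addrA addrC.
Qed.
Lemma e0_xp k : e0 (xp k) = k. Proof. by rewrite /e0 rt_xp add0r. Qed.
Lemma e0_gp e : e0 (gp e) = 0%R. Proof. by []. Qed.
Lemma e0_1 : e0 1 = 0%R. Proof. by []. Qed.

(** The rotation of [g] permutes the sections of [h] cyclically, which a sum over all positions does
    not see. *)
Lemma e1M g h :
  rot g -> (forall y, rot (sec h y)) -> e1 (g * h) = (e1 g + e1 h)%R.
Proof.
move=> Rg Rh; rewrite /e1 [X in (_ + X)%R](reindex_inj (addIr (e0 g))) -big_split /=.
by apply: eq_bigr => y _; rewrite secM e0M // Rg.
Qed.

Lemma e1_xp k : e1 (xp k) = 0%R.
Proof. by rewrite /e1 big1 // => y _; rewrite sec_xp. Qed.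

Lemma big_I3 (F : 'I_3 -> 'I_3) : (\sum_y F y = F 0 + F 1 + F 2)%R.
Proof.
rewrite !big_ord_recl big_ord0 addr0 addrA.
by congr (F _ + F _ + F _)%R; apply: val_inj.
Qed.

Lemma e1_gp e : e1 (gp e) = e.
Proof. by rewrite /e1 big_I3 !sec_gp /= e0_gp e0_xp e0_1 add0r addr0. Qed.

Lemma phi_rot g : g \in phi -> rot g.
Proof. by elim/phi_ind => *; [exact: rot_xp | exact: rot_id | exact: rotM]. Qed.

Lemma phi_sec g y : g \in phi -> sec g y \in phi.
Proof.
move=> Pg; elim/phi_ind: Pg y => [k|e|f h _ _ IHf IHh] y.
- by rewrite sec_xp gpred1.
- by rewrite sec_gp; do 2?case: ifP => _; rewrite ?gpred1 ?phi_gp ?phi_xp.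
by rewrite secM gpredM.
Qed.

Lemma phi_e0M g h : h \in phi -> e0 (g * h) = (e0 g + e0 h)%R.
Proof. by move=> /phi_rot; exact: e0M. Qed.

Lemma phi_e1M g h : g \in phi -> h \in phi -> e1 (g * h) = (e1 g + e1 h)%R.
Proof. by move=> /phi_rot Rg Ph; apply: e1M => // y; exact/phi_rot/phi_sec. Qed.

Lemma phi_e0V g : g \in phi -> e0 g^-1 = (- e0 g)%R.
Proof. by move=> /phi_rot; exact: e0V. Qed.

Lemma e1_1 : e1 1 = 0%R. Proof. by rewrite -xp0 e1_xp. Qed.

Lemma phi_e1V g : g \in phi -> e1 g^-1 = (- e1 g)%R.
Proof.
move=> Pg; apply/eqP; rewrite -addr_eq0 -phi_e1M ?gpredV //.
by rewrite mulVg e1_1.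
Qed.

(** Conjugates of gamma place gamma^e at one position and x^e at the next, and both sides are
    additive on Phi. *)
Lemma phi_rel g y : g \in phi -> e1 (sec g y) = e0 (sec g (y + 1)).
Proof.
move=> Pg; elim/phi_ind: Pg y => [k|e|f h Pf Ph IHf IHh] y.
- by rewrite !sec_xp e1_1.
- rewrite !sec_gp; case: (I3P y) => -> /=; rewrite ?e1_gp ?e0_xp ?e1_xp ?e1_1 //.
rewrite !secM phi_e1M ?phi_e0M ?phi_sec // IHf IHh.
by rewrite !(phi_rot Pf) addrAC.
Qed.

(** * Branching and the membership criterion for Phi *)

Lemma diagM f g : diag f * diag g = diag (fun y => f y * g y).
Proof. by apply: aut_eqP => y; rewrite ?rtM ?secM !(rt_diag, sec_diag). Qed.

Lemma aut_diag g : rot g -> g = diag (sec g) * xp (e0 g).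
Proof.
move=> Rg; apply: aut_eqP => y;
  by rewrite ?rtM ?secM !(rt_diag, sec_diag) ?rt_xp ?sec_xp ?mulg1.
Qed.

(* For fixed y, [spread] is multiplicative on Phi, because the entries other
   than g only depend on the abelianisation; on generators it takes values in
   Phi, so Phi is branch over the kernel of (e0, e1). *)
Definition spread (y : 'I_3) g :=
  diag (fun z =>
    if z == y then g else if z == (y + 1)%R then xp (e1 g) else gp (e0 g)).

Arguments spread y%_R.

Lemma phi_spread y g : g \in phi -> spread y g \in phi.
Proof.
elim/phi_ind=> [k|e|f h Pf Ph IHf IHh].
(* The entry x^k at [y] comes from a gamma^k one position earlier, that is at [y + 2]. *)
- suff ->: spread y (xp k) = gconj ((y + 2)%R, k) by exact: phi_gconj.
  apply: aut_eqP => z; first by rewrite rt_gconj.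
  rewrite sec_diag sec_gconj e1_xp e0_xp xp0.
  by case: (I3P y) => ->; case: (I3P z) => ->.
- suff ->: spread y (gp e) = gconj (y, e) by exact: phi_gconj.
  apply: aut_eqP => z; first by rewrite rt_gconj.
  by rewrite sec_diag sec_gconj e1_gp e0_gp gp0.
suff ->: spread y (f * h) = spread y f * spread y h by exact: gpredM.
rewrite diagM; apply: aut_eqP => z //; rewrite !sec_diag phi_e0M ?phi_e1M //.
by do 2?case: (_ == _); rewrite ?xpD ?gpD.
Qed.

Lemma phi_diag0 g :
    (forall y, [/\ g y \in phi, e0 (g y) = 0%R & e1 (g y) = 0%R]) ->
  diag g \in phi.
Proof.
move=> Pg; have Ps y : spread y (g y) \in phi by apply: phi_spread; case: (Pg y).
suff ->: diag g = spread 0 (g 0%R) * spread 1 (g 1%R) * spread 2 (g 2%R).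
  by rewrite !gpredM.
rewrite !diagM; apply: aut_eqP => // y; rewrite !sec_diag.
have E0 z : e0 (g z) = 0%R by case: (Pg z).
have E1 z : e1 (g z) = 0%R by case: (Pg z).
by rewrite !E0 !E1 xp0 gp0; case: (I3P y) => -> /=; rewrite ?mulg1 ?mul1g.
Qed.

(** The relation of [phi_rel] is also sufficient: dividing by a product [h] of three conjugates with
    the same exponents leaves sections in the kernel of [e0] and [e1], where [phi_diag0] applies. *)
Lemma phi_diag g :
    (forall y, g y \in phi) -> (forall y, e1 (g y) = e0 (g (y + 1)%R)) ->
  diag g \in phi.
Proof.
move=> Pg Eg; pose a y := e1 (g y).
pose h := gconj (0, a 0)%R * gconj (1, a 1)%R * gconj (2, a 2)%R.
have Ph : h \in phi by rewrite !gpredM ?phi_gconj.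
have Rh y : rt h y = y by rewrite !rtM !rt_gconj.
have Eh y : e1 (sec h y) = a y /\ e0 (sec h y) = a (y - 1)%R.
  rewrite !secM !rtM !rt_gconj !sec_gconj /=.
  case: (I3P y) => -> /=; rewrite ?mul1g ?mulg1;
    rewrite phi_e1M ?phi_e0M ?phi_xp ?phi_gp // e1_xp e1_gp e0_xp e0_gp add0r addr0;
    by split=> //; congr (a _); apply: val_inj.
clearbody h.
have ->: diag g = h * diag (fun y => (sec h y)^-1 * g y).
  apply: aut_eqP => y; first by rewrite rtM Rh.
  by rewrite secM !sec_diag Rh mulVKg.
rewrite gpredM // phi_diag0 // => y; have [E1 E0] := Eh y.
have {}E0 : e0 (sec h y) = e0 (g y) by rewrite E0 /a Eg subrK.
have Psec := phi_sec y Ph.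
rewrite gpredM ?gpredV // phi_e0M // phi_e1M ?gpredV //.
by rewrite phi_e0V // phi_e1V // E1 E0 !addNr.
Qed.

Lemma phi_crit g :
    rot g -> (forall y, sec g y \in phi) ->
    (forall y, e1 (sec g y) = e0 (sec g (y + 1))) ->
  g \in phi.
Proof. by move=> Rg Ps Es; rewrite (aut_diag Rg) gpredM ?phi_xp // phi_diag. Qed.

(** * The normalizer of Phi and its sections *)

Definition norm : {pred aut} := fun f =>
  `[< forall h, h \in phi -> h ^ f \in phi /\ h ^ f^-1 \in phi >].

Lemma normP f :
  reflect (forall h, h \in phi -> h ^ f \in phi /\ h ^ f^-1 \in phi) (f \in norm).
Proof. exact: asboolP. Qed.

Lemma normJ f h : f \in norm -> h \in phi -> h ^ f \in phi.
Proof. by move=> /normP Nf /Nf[]. Qed.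

Fact norm_one : 1 \in norm.
Proof. by apply/normP => h Ph; rewrite invg1 !conjg1. Qed.
Fact norm_inv : invg_closed norm.
Proof. by move=> f /normP Nf; apply/normP => h /Nf[]; rewrite invgK. Qed.
Fact norm_mul : mulg_closed norm.
Proof.
move=> f g Nf Ng; apply/normP => h Ph; rewrite invgM !conjgM.
by rewrite !normJ // norm_inv.
Qed.
HB.instance Definition _ := isMulClosed.Build aut norm norm_mul.
HB.instance Definition _ := isMul1Closed.Build aut norm norm_one.
HB.instance Definition _ := isInvClosed.Build aut norm norm_inv.

Lemma phi_norm g : g \in phi -> g \in norm.
Proof. by move=> Pg; apply/normP => h Ph; rewrite !gpredJ ?gpredV. Qed.

Lemma I3_neq (y : 'I_3) : (y + 1)%R <> y.
Proof. by case: (I3P y) => ->. Qed.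

Lemma e0_xpJ f : e0 (xp 1 ^ f) <> 0%R.
Proof.
move=> E; have := rtJ (xp 1) f (rt f^-1 0); rewrite rtVK -/(e0 _) E rt_xp.
by move=> /(congr1 (rt f^-1)); rewrite rtK => /esym/I3_neq.
Qed.

(* Excludes a transposition at the root: by [phi_rel] the entries conjugate to
   gamma and x must stay in cyclically consecutive positions. *)
Lemma norm_rt_succ f y : f \in norm -> rt f (y + 1) = (rt f y + 1)%R.
Proof.
(* [z] is the position sent just before the image of [y + 1]. The section at that image is a
   conjugate of x, so [e0] is nonzero there; by [phi_rel] the section coming from [z] has nonzero
   [e1], which only [z = y] allows. *)
move=> Nf; pose w := (rt f (y + 1) - 1)%R; pose z := rt f^-1 w.
have Ew : rt f z = w by rewrite rtVK.
have S u : sec (gconj (y, 1%R) ^ f) (rt f u) = sec (gconj (y, 1%R)) u ^ sec f u.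
  by rewrite secJ rt_gconj.
have ny : (y + 1 == y)%R = false by apply/eqP/I3_neq.
have := phi_rel w (normJ Nf (phi_gconj (y, 1%R))).
rewrite {2}/w subrK -Ew !S !sec_gconj /= eqxx ny.
clearbody z; case: eqP => [zy _|_]; first by rewrite -[in RHS]zy Ew subrK.
case: eqP => [zy|_].
  by move/eqP: Ew; rewrite zy eq_sym subr_eq eq_sym => /eqP/I3_neq.
by rewrite conj1g e1_1 => /esym/e0_xpJ.
Qed.

Lemma norm_rot f : f \in norm -> rot f.
Proof. by move=> Nf; apply: rot_succ => y; exact: norm_rt_succ. Qed.

Lemma sec_spreadJ f y g :
  sec (spread y g ^ f) (rt f y) = g ^ sec f y.
Proof. by rewrite secJ rt_diag sec_diag eqxx. Qed.

(** Every [g] in Phi is the section at [y] of [spread y g], again in Phi, so its conjugate by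
    [sec f y] is a section of a conjugate by [f]. *)
Lemma norm_sec f y : f \in norm -> sec f y \in norm.
Proof.
move=> Nf; apply/normP => h Ph; rewrite -secV -sec_spreadJ.
have := sec_spreadJ f^-1 (rt f y) h; rewrite rtK => <-.
by rewrite !phi_sec // normJ ?gpredV ?phi_spread.
Qed.

(** This quotient is a section of the conjugate by [f] of the power of x taking [y] to [z]. *)
Lemma norm_sec_phi f y z : f \in norm -> (sec f y)^-1 * sec f z \in phi.
Proof.
move=> Nf; have := phi_sec (rt f y) (normJ Nf (phi_xp (z - y)%R)).
by rewrite secJ rt_xp sec_xp mul1g addrC subrK.
Qed.

Lemma norm_e0J f g : f \in norm -> g \in phi -> e0 (g ^ f) = e0 g.
Proof.
move=> /norm_rot Rf /phi_rot Rg; have Rf' := rotV Rf.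
by rewrite !e0M ?e0V //; [rewrite addrCA addNr addr0 | exact: rotM].
Qed.

(** The sections of [f] enter once with each sign, at positions differing by a rotation, and cancel
    in the sum. *)
Lemma norm_e1J f g : f \in norm -> g \in phi -> e1 (g ^ f) = e1 g.
Proof.
move=> Nf Pg; rewrite /e1 (reindex_inj (can_inj (rtK f))) /=.
have Rf y := norm_rot (norm_sec y Nf); have Rg y := phi_rot (phi_sec y Pg).
under eq_bigr => y _.
  rewrite secJ !e0M ?e0V //; last exact: rotM.
  rewrite (phi_rot Pg); over.
rewrite !big_split /= addrCA sumrN.
rewrite [X in (- X)%R](reindex_inj (addIr (e0 g))) /=.
by rewrite addNr addr0.
Qed.

Lemma norm_delta h : h \in norm -> delta h \in norm.
Proof.
suff H f : f \in norm -> forall g, g \in phi -> g ^ delta f \in phi.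
  by move=> Nh; apply/normP => g Pg; rewrite -deltaV !H ?gpredV.
move=> Nf g Pg.
have Er y : rt (g ^ delta f) y = rt g y.
  by rewrite -[y in LHS](rt_diag (fun=> f)) rtJ rt_diag.
have Es y : sec (g ^ delta f) y = sec g y ^ f.
  by rewrite -[y in LHS](rt_diag (fun=> f)) secJ !sec_diag.
apply: phi_crit => [y|y|y].
- by rewrite /e0 !Er (phi_rot Pg).
- by rewrite Es normJ ?phi_sec.
by rewrite !Es norm_e1J ?norm_e0J ?phi_sec // phi_rel.
Qed.

(** * Reduction modulo U and Phi to a single section *)

Lemma delta_xpC g k : delta g * xp k = xp k * delta g.
Proof.
apply: aut_eqP => y; first by rewrite !rtM !rt_diag.
by rewrite !secM !sec_diag !sec_xp mulg1 mul1g.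
Qed.

(* [delta (transl ks)] ranges over U. *)
Fixpoint transl (ks : seq 'I_3) : aut :=
  if ks is k :: ls then xp k * delta (transl ls) else 1.

Lemma transl_norm ks : transl ks \in norm.
Proof.
elim: ks => [|k ks IH] /=; first exact: gpred1.
by rewrite gpredM ?norm_delta // phi_norm ?phi_xp.
Qed.

Definition in_Uphi f := exists ks g, g \in phi /\ f = delta (transl ks) * g.

Lemma in_UphiM f g : g \in phi -> in_Uphi f -> in_Uphi (f * g).
Proof.
by move=> Pg [ks [h [Ph ->]]]; exists ks, (h * g); rewrite gpredM // mulgA.
Qed.

Lemma in_UphiMK f g : g \in phi -> in_Uphi (f * g) -> in_Uphi f.
Proof. by move=> Pg G; rewrite -(mulgK g f); apply: in_UphiM; rewrite ?gpredV. Qed.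

(** The relation of [phi_rel] fails for [delta g] by the constant [e1 g - e0 g]; a factor x^d in
    each section raises [e0] by d, leaves [e1] alone and so repairs it. *)
Lemma delta_phi g : g \in phi ->
  exists k h, h \in phi /\ delta g = delta (xp k) * h.
Proof.
move=> Pg; pose d := (e1 g - e0 g)%R.
exists (- d)%R, (delta (xp d * g)); split; last first.
  by rewrite xpN deltaM deltaV mulKg.
apply: phi_diag => y; first by rewrite gpredM ?phi_xp.
by rewrite phi_e1M ?phi_xp // phi_e0M // e1_xp e0_xp add0r subrK.
Qed.

Lemma norm_decomp f y : f \in norm ->
  exists k h, h \in phi /\ f = delta (sec f y * xp k) * h.
Proof.
move=> Nf; pose p := (delta (sec f y))^-1 * f.
have Np : p \in norm by rewrite gpredM ?gpredV ?norm_delta ?norm_sec.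
have Pp z : sec p z \in phi.
  by rewrite secM -deltaV sec_diag rt_diag norm_sec_phi.
(* The defect of [p] in the relation of [phi_rel] is the same at all positions, because the
   conjugate of x by [p] lies in Phi and satisfies that relation. One diagonal power of x therefore
   corrects [p]. *)
have Ed z : (e1 (sec p (z + 1)) - e0 (sec p (z + 1 + 1)) =
             e1 (sec p z) - e0 (sec p (z + 1)))%R.
  have := phi_rel (rt p z) (normJ Np (phi_xp 1%R)).
  rewrite -norm_rt_succ // !secJ !rt_xp !sec_xp !mul1g.
  rewrite phi_e1M ?gpredV // phi_e0M // phi_e1V // phi_e0V // => E.
  by rewrite -[e1 (sec p (z + 1))](addNKr (e1 (sec p z))) E addrA addrK.
pose d := (e1 (sec p 0) - e0 (sec p 1))%R.
have Dz z : (e1 (sec p z) = d + e0 (sec p (z + 1)))%R.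
  apply/eqP; rewrite -subr_eq; apply/eqP.
  have E0 := Ed 0%R; have E1 := Ed 1%R; rewrite !add0r in E0.
  by case: (I3P z) => ->; rewrite ?add0r // E1.
exists (- d)%R, (delta (xp d) * p); split; last first.
  by rewrite deltaM xpN deltaV mulgA mulgVK mulVKg.
have Es z : sec (delta (xp d) * p) z = xp d * sec p z.
  by rewrite secM sec_diag rt_diag.
apply: phi_crit => [|z|z].
- by apply: norm_rot; rewrite gpredM ?norm_delta // phi_norm ?phi_xp.
- by rewrite Es gpredM ?phi_xp.
by rewrite !Es phi_e1M ?phi_xp // phi_e0M // e1_xp e0_xp add0r.
Qed.

(** Applying [delta] once more lengthens the exponent list by one: [delta_phi] trades [delta g] for
    some [delta (xp j)] modulo Phi, and [j] becomes the new head. *)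
Lemma in_Uphi_sec f y : f \in norm -> in_Uphi (sec f y) -> in_Uphi f.
Proof.
move=> Nf Gs; have [k [h [Ph ->]]] := norm_decomp y Nf; apply: in_UphiM => //.
have [ks [g [Pg ->]]] := in_UphiM (phi_xp k) Gs.
have [j [g' [Pg' E]]] := delta_phi Pg.
exists (j :: ks), g'; split=> //=.
by rewrite deltaM E mulgA -deltaM delta_xpC.
Qed.

(** * Isometries commuting with x or gamma *)

Lemma commute_xp_sec f y z : commute f (xp 1) -> sec f y = sec f z.
Proof.
move=> Cf; have S u : sec f (u + 1) = sec f u.
  have := congr1 (fun g => sec g u) Cf.
  by rewrite !secM !sec_xp rt_xp mulg1 mul1g.
suff S0 u : sec f u = sec f 0 by rewrite S0 (S0 z).
have E1 := S 0%R; have E2 := S 1%R; rewrite add0r in E1.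
by case: (I3P u) => ->; rewrite // -E1 -?E2.
Qed.

Lemma commute_xp_rot f : commute f (xp 1) -> rot f.
Proof.
move=> Cf; apply: rot_succ => y.
by have := congr1 (fun g => rt g y) Cf; rewrite !rtM !rt_xp.
Qed.

(** Position 2 is the only one where gamma has trivial section, so [f] fixes it, and a rotation with
    a fixed point is trivial. *)
Lemma commute_gp_rt f : rot f -> commute f (gp 1) -> rt f =1 id.
Proof.
move=> Rf Cf; suff E : e0 f = 0%R by move=> y; rewrite Rf E addr0.
have := congr1 (fun g => sec g 2) Cf.
rewrite !secM rt_gp [sec (gp 1) 2]sec_gp mul1g Rf.
rewrite -[RHS in _ = RHS]mulg1 => /mulgI; rewrite sec_gp.
case: (I3P (e0 f)) => -> //=.
  by rewrite -gp0 => /gp_inj.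
by rewrite -xp0 => /xp_inj.
Qed.

Lemma commute_gp_sec f : rt f =1 id -> commute f (gp 1) ->
  commute (sec f 0) (gp 1) /\ commute (sec f 1) (xp 1).
Proof.
move=> Rf Cf; have C y : commute (sec f y) (sec (gp 1) y).
  by have := congr1 (fun g => sec g y) Cf; rewrite !secM Rf rt_gp.
by have := C 0%R; have := C 1%R; rewrite !sec_gp.
Qed.

(** Commuting with x makes all sections equal; by [commute_gp_sec] the common section commutes with
    both generators again, so induction on words applies. *)
Lemma commute_gens_eq1 f : commute f (xp 1) -> commute f (gp 1) -> f = 1.
Proof.
move=> Cx Cg; apply: aut_ext => w; elim: w f Cx Cg => [|y w IH] f Cx Cg.
  exact: aut0.
have Rf := commute_gp_rt (commute_xp_rot Cx) Cg.
have [C0 C1] := commute_gp_sec Rf Cg.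
rewrite !aut_cons Rf sec1; congr (_ :: _); apply: IH.
  by rewrite (commute_xp_sec y 1%R Cx).
by rewrite (commute_xp_sec y 0%R Cx).
Qed.

(** * The two length descents *)

Lemma in_Uphi1 : in_Uphi 1.
Proof. by exists [::], 1; rewrite gpred1 /= delta1 mulg1. Qed.

Lemma size_count_I3 (s : seq ('I_3 * 'I_3)) :
  size s = count (fun p => p.1 == 0%R) s + count (fun p => p.1 == 1%R) s
           + count (fun p => p.1 == 2%R) s.
Proof.
elim: s => //= -[i e] s ->; case: (I3P i) => -> /=; rewrite ?add0n ?add1n //.
  by rewrite addnS addSn.
by rewrite addnS.
Qed.

(* The sections satisfy f_1 = f_0 s_0 s_1^-1, where s_0 s_1^-1 has
   fewer letters than s up to a power of gamma on the left, which f_0 absorbs. *)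
Lemma in_Uphi_commute s f :
    f \in norm -> commute f (gp 1) -> commute (f * gword s) (xp 1) ->
  in_Uphi f.
Proof.
have [n] := ubnP (size s); elim: n s f => // n IH s f le_s Nf Cg Cx.
have [s0|s_gt0] := posnP (size s).
  move: Cx; rewrite (size0nil s0) gword_nil mulg1 => Cx.
  by rewrite (commute_gens_eq1 Cx Cg); exact: in_Uphi1.
have Rf := commute_gp_rt (norm_rot Nf) Cg.
pose F y := sec f y; pose P y := sec (gword s) y.
have [C0 C1] := commute_gp_sec Rf Cg; rewrite -/(F _) -/(F _) in C0 C1.
have EF : F 1%R = F 0%R * (P 0%R * (P 1%R)^-1).
  have := commute_xp_sec 0%R 1%R Cx; rewrite !secM !Rf -/(F _) -/(F _) => E.
  by rewrite mulgA E mulgK.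
suff [e [m [m_small [t [k [le_t Et]]]]]] : exists e m,
    m < size s /\ len m ((gp e)^-1 * (P 0%R * (P 1%R)^-1)).
  apply: (@in_Uphi_sec _ 0%R) => //; apply: (in_UphiMK (phi_gp e)).
  (* The induction hypothesis is used for [sec f 0 * gp e], which still commutes with gamma; its
     product with [gword t] is [sec f 1] times a power of x, hence commutes with x. *)
  apply: (IH t); first by rewrite (leq_ltn_trans le_t) // (leq_trans m_small).
  - by rewrite gpredM ?norm_sec // phi_norm ?phi_gp.
  - apply/commute_sym/commuteM; apply/commute_sym => //.
    by rewrite /commute -!gpD addrC.
  have -> : sec f 0 * gp e * gword t = F 1%R * xp (- k).
    by rewrite xpN; apply: (canRL (mulgK _)); rewrite -mulgA -Et -mulgA mulVKg EF.
  apply/commute_sym/commuteM; apply/commute_sym => //.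
  exact: xpC.
have L0 := len_sec_gword s 0%R; have L1 := len_sec_gword s 1%R.
have Es := size_count_I3 s.
(* A letter at position 2 gives no gamma-letter to sections 0 and 1, so their joint length already
   drops. *)
have [n2|n2] := posnP (count (fun p => p.1 == 2%R) s); last first.
  exists 0%R; exists (count (fun p => p.1 == 0%R) s + count (fun p => p.1 == 1%R) s).
  split; first by rewrite Es -[X in X < _]addn0 ltn_add2l.
  by rewrite gp0 invg1 mul1g; apply: lenM L0 (lenV L1).
have [e Pe] : exists e, P 0%R = gp e.
  by apply: sec0_gword; move/eqP: n2; rewrite -leqn0 leqNgt -has_count -all_predC.
have [n0|n0] := posnP (count (fun p => p.1 == 0%R) s); last first.
  exists e, (count (fun p => p.1 == 1%R) s); split.
    by rewrite Es n2 addn0 -[X in X < _]add0n ltn_add2r.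
  by rewrite Pe mulKg; apply: lenV.
have [a Ea] : exists a, gword s = gconj (1%R, a).
  by apply: gword_const; rewrite all_count Es n2 n0 addn0.
(* With all letters at position 1, section 0 is trivial and section 1 is gamma^a, so [gp (- a)]
   cancels everything. *)
exists (- a)%R, 0; split=> //; rewrite /P Ea !sec_gconj /=.
by rewrite mul1g gpN invgK mulgV; exact: len1.
Qed.

Lemma norm_in_Uphi f : f \in norm -> in_Uphi f.
Proof.
move=> Nf; have /phiP[n] := normJ Nf (phi_gp 1%R).
elim/ltn_ind: n f Nf => n IH f0 Nf0 L0.
(* A power of x makes the root action trivial; conjugating by it keeps the length bound. *)
apply: (@in_UphiMK _ (xp (- e0 f0))); first exact: phi_xp.
set f := _ * _.
have Nf : f \in norm by rewrite gpredM // phi_norm ?phi_xp.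
have Rf y : rt f y = y by rewrite rtM rt_xp (norm_rot Nf0) addrK.
have : len n (gp 1 ^ f) by rewrite conjgM; exact: lenJ.
move: f Nf Rf => f Nf Rf {f0 Nf0 L0} [s [k [le_s Es]]].
have Ef y : sec (gword s) y = sec (gp 1) y ^ sec f y.
  have := congr1 (fun g => sec g y) Es; rewrite secM sec_xp mulg1 => <-.
  by rewrite -{1}(Rf y) secJ rt_gp.
apply: (@in_Uphi_sec _ 0%R) => //.
(* The conjugate of gamma by [sec f 0] is section 0 of the word, which is shorter as soon as some
   letter lies elsewhere. *)
have [a0|a0] := boolP (all (fun p => p.1 == 0%R) s); last first.
  apply: (IH (count (fun p => p.1 == 0%R) s)); last 2 first.
  - exact: norm_sec.
  - by have := len_sec_gword s 0%R; rewrite Ef sec_gp.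
  by apply: leq_trans le_s; rewrite ltn_neqAle count_size andbT -all_count.
(* Otherwise the conjugate is gamma^a x^k, and invariance of [e0] in section 1 and at the root gives
   a = 1 and k = 0. *)
have [a Ea] := gword_const a0.
have a1 : a = 1%R.
  have := Ef 1%R; rewrite Ea sec_gconj sec_gp /= => /(congr1 e0).
  by rewrite norm_e0J ?phi_xp ?norm_sec // !e0_xp.
have k0 : k = 0%R.
  have := congr1 e0 Es; rewrite norm_e0J ?phi_gp // e0_gp phi_e0M ?phi_xp //.
  by rewrite Ea e0_xp /e0 rt_gconj add0r.
have Cf : commute f (gp 1).
  move: Es; rewrite Ea k0 a1 xp0 mulg1 gconjE xp0 conjg1 /= => E.
  by rewrite /commute [RHS]conjgC E.
have [C0 C1] := commute_gp_sec Rf Cf.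
have /phiP[_ [t [l [_ Et]]]] := norm_sec_phi 0%R 1%R Nf.
apply: (@in_Uphi_commute t) => //; first exact: norm_sec.
have -> : sec f 0 * gword t = sec f 1 * xp (- l).
  by rewrite xpN; apply: (canRL (mulgK _)); rewrite -mulgA -Et mulVKg.
apply/commute_sym/commuteM; last exact: xpC.
exact: commute_sym.
Qed.

(** * Transfer to [Phi], [U] and [normalizes] on plain functions *)

Lemma gen_tmul S f g : gen S f -> gen S g -> gen S (tmul f g).
Proof.
move=> Gf Gg; elim: Gf => [|s h Ss _ IH|s s' h Ss sK s'K _ IH] //.
  exact: gen_mul Ss IH.
exact: gen_inv Ss sK s'K IH.
Qed.

Lemma gen_incl (S : tfun -> Prop) s : S s -> gen S s.
Proof. by move=> Ss; exact: gen_mul Ss (gen_id S). Qed.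

Lemma autV_eq (s : aut) s' : cancel s s' -> s' = aut_fun s^-1.
Proof.
by move=> sK; apply: funext => w; rewrite -{1}(aut_invK s w) sK.
Qed.

Lemma PhiP f : Phi f <-> exists2 g, g \in phi & f = aut_fun g.
Proof.
split; last first.
  have Px : Phi (xp 1) by apply: gen_incl; left; exact: xp1E.
  have Pg : Phi (gp 1) by apply: gen_incl; right; exact: gp1E.
  case=> g Pg' ->; elim/phi_ind: Pg' => [k|e|h1 h2 _ _]; last exact: gen_tmul.
    case: (I3P k) => ->; [rewrite xp0; exact: gen_id | by [] |].
    by rewrite -[2%R]/(1 + 1)%R xpD; exact: gen_tmul.
  case: (I3P e) => ->; [rewrite gp0; exact: gen_id | by [] |].
  by rewrite -[2%R]/(1 + 1)%R gpD; exact: gen_tmul.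
have gens s : s = xf \/ s = gammaf -> exists2 g, g \in phi & s = aut_fun g.
  case=> ->; first by exists (xp 1); rewrite ?phi_xp ?xp1E.
  by exists (gp 1); rewrite ?phi_gp ?gp1E.
elim=> [|s g /gens[a Pa ->] _ [b Pb ->]|s s' g /gens[a Pa ->] sK _ _ [b Pb ->]].
- by exists 1; rewrite ?gpred1.
- by exists (a * b); rewrite ?gpredM.
by exists (a^-1 * b); rewrite ?gpredM ?gpredV // (autV_eq sK).
Qed.

Lemma translM k l g h :
  (xp k * delta g) * (xp l * delta h) = xp (k + l) * delta (g * h).
Proof. by rewrite mulgA -[X in X * _]mulgA delta_xpC mulgA -xpD -mulgA -deltaM. Qed.

(** Exponent lists add entrywise, the shorter one padded with zeros. *)
Lemma transl_mul ks ls : exists ms, transl ks * transl ls = transl ms.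
Proof.
elim: ks ls => [|k ks IH] [|l ls] /=.
- by exists [::]; rewrite mulg1.
- by exists (l :: ls); rewrite mul1g.
- by exists (k :: ks); rewrite mulg1.
by have [ms E] := IH ls; exists ((k + l)%R :: ms); rewrite translM E.
Qed.

Lemma transl_inv ks : exists ms, (transl ks)^-1 = transl ms.
Proof.
elim: ks => [|k ks [ms E]] /=; first by exists [::]; rewrite invg1.
by exists ((- k)%R :: ms); rewrite /= invgM -xpN -deltaV E delta_xpC.
Qed.

Lemma translC ks ls : transl ks * transl ls = transl ls * transl ks.
Proof.
elim: ks ls => [|k ks IH] [|l ls] /=; rewrite ?mulg1 ?mul1g //.
by rewrite !translM IH addrC.
Qed.

Lemma addr3_I3 (a : 'I_3) : (a + a + a = 0)%R.
Proof. by case: (I3P a) => ->; apply: val_inj. Qed.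

Lemma transl_cube ks : transl ks * (transl ks * transl ks) = 1.
Proof.
elim: ks => [|k ks IH] /=; first by rewrite !mulg1.
by rewrite !translM IH delta1 mulg1 -xp0 addrA addr3_I3.
Qed.

Lemma iter_deltaE n g : iter n Delta (aut_fun g) = aut_fun (iter n delta g).
Proof. by elim: n => // n IH; rewrite iterS IH -deltaE. Qed.

Lemma iter_deltaM n g h : iter n delta (g * h) = iter n delta g * iter n delta h.
Proof. by elim: n => //= n ->; rewrite deltaM. Qed.

Lemma iter_delta1 n : iter n delta 1 = 1.
Proof. by elim: n => //= n ->; rewrite delta1. Qed.

Lemma aut_fun_inj : injective aut_fun.
Proof. by move=> g h E; apply: aut_ext => w; rewrite E. Qed.

Lemma UP f : U f <-> exists ks, f = aut_fun (delta (transl ks)).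
Proof.
split; last first.
  have Ux n k : 0 < n -> U (iter n delta (xp k)).
    move=> n_gt0; have U1 : U (iter n delta (xp 1)).
      by apply: gen_incl; exists n; rewrite -xp1E iter_deltaE.
    case: (I3P k) => ->; [rewrite xp0 iter_delta1; exact: gen_id | by [] |].
    by rewrite -[2%R]/(1 + 1)%R xpD iter_deltaM; exact: gen_tmul.
  have Ut ks : forall n, 0 < n -> U (iter n delta (transl ks)).
    elim: ks => [|k ks IH] n n_gt0 /=; first by rewrite iter_delta1; exact: gen_id.
    rewrite iter_deltaM; apply: gen_tmul; first exact: Ux.
    by rewrite -iterSr; exact: IH.
  by case=> ks ->; exact: (Ut ks 1%N isT).
have gens s : (exists n, 1 <= n /\ s = iter n Delta xf) ->
    exists ks, s = aut_fun (delta (transl ks)).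
  (* One of the iterations is the outer [delta], so the exponent 1 is preceded by one zero fewer
     than the number of iterations. *)
  case=> -[|n] [// _ ->]; exists (ncons n 0%R [:: 1%R]).
  rewrite -xp1E iter_deltaE; congr aut_fun; rewrite /=; congr delta.
  by elim: n => [|n IH] /=; rewrite ?delta1 ?mulg1 // xp0 mul1g IH.
elim=> [|s g /gens[ks ->] _ [ls ->]|s s' g /gens[ks ->] sK _ _ [ls ->]].
- by exists [::]; rewrite [delta _]delta1.
- by have [ms E] := transl_mul ks ls; exists ms; rewrite -E deltaM.
have [ms E] := transl_inv ks; have [ns F] := transl_mul ms ls; exists ns.
by rewrite -F deltaM -E deltaV (autV_eq sK).
Qed.

(** In the repeated section [e0] is the leading exponent, while [e1] adds three equal terms and
    vanishes modulo 3; [phi_rel] thus kills the leading exponent, and passing to a section removes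
    it. *)
Lemma phi_delta_transl ks : delta (transl ks) \in phi -> transl ks = 1.
Proof.
elim: ks => //= k ks IH Pd.
have Et : sec (delta (xp k * delta (transl ks))) 0 = xp k * delta (transl ks).
  exact: sec_diag.
have Pt := phi_sec 0%R Pd; rewrite Et in Pt.
have k0 : k = 0%R.
  have := phi_rel 0%R Pd; rewrite !sec_diag.
  rewrite /e0 rtM rt_diag rt_xp add0r => <-.
  rewrite /e1 big_I3 !secM !sec_xp !sec_diag !mul1g.
  exact: addr3_I3.
by move: Pt; rewrite k0 xp0 mul1g => /IH->; rewrite delta1.
Qed.

Lemma iter_delta_inj m n : iter m delta (xp 1) = iter n delta (xp 1) -> m = n.
Proof.
elim: m n => [|m IH] [|n] //= E; last by congr _.+1; apply/IH/delta_inj.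
  by have := rt_xp 1%R 0%R; rewrite E.
by have := rt_xp 1%R 0%R; rewrite -E.
Qed.

Lemma normalizesP f : normalizes Phi f <-> exists2 g, g \in norm & f = aut_fun g.
Proof.
have conjE (a b : aut) : tmul (tmul (aut_fun a^-1) b) a = aut_fun (b ^ a).
  by rewrite conjgE mulgA.
have PhiE (a : aut) : Phi a <-> a \in phi.
  split=> [/PhiP[b Pb /aut_fun_inj->] //|Pa].
  by apply/PhiP; exists a.
split=> [[[_ [sf tf]] [f' [fK [f'K Nf]]]]|[g Ng ->]].
  pose g := Aut fK f'K sf tf; exists g => //; apply/normP => h /PhiE Ph.
  have [/(_ Ph) H1 /(_ Ph) H2] := Nf h; split; apply/PhiE.
    by rewrite -conjE.
  by rewrite -conjE invgK.
split; first exact: aut_isometry.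
exists (aut_fun g^-1); split; first exact: aut_funK.
split; first exact: aut_invK.
move=> h; split=> /PhiP[k Pk ->]; first by rewrite conjE PhiE normJ.
by rewrite -[in tmul (tmul (aut_fun g) _) _](invgK g) conjE PhiE normJ ?gpredV.
Qed.

Theorem theorem5p14 :
  (* U is an elementary abelian 3-group, and countably infinite *)
  (forall u v, U u -> U v -> tmul u v = tmul v u) /\
  (forall u, U u -> tmul u (tmul u u) = tid) /\
  (forall m n, 1 <= m -> 1 <= n -> iter m Delta xf = iter n Delta xf -> m = n) /\
  (* Aut(Phi) = N_W(Phi) = Phi : U, a split extension *)
  (forall f, normalizes Phi f <-> exists p u, Phi p /\ U u /\ f = tmul p u) /\
  (forall f, Phi f -> U f -> f = tid).
Proof.
have aut_tmul (g h : aut) : tmul g h = aut_fun (g * h) by [].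
split=> [u v /UP[ks ->] /UP[ls ->]|].
  by rewrite !aut_tmul -!deltaM translC.
split=> [u /UP[ks ->]|]; first by rewrite !aut_tmul -!deltaM transl_cube delta1.
split=> [m n _ _|].
  by rewrite -xp1E !iter_deltaE => /aut_fun_inj/iter_delta_inj.
split=> [f|f /PhiP[g Pg ->] /UP[ks /aut_fun_inj E]]; last first.
  by move: Pg; rewrite E => /phi_delta_transl->; rewrite delta1.
split=> [/normalizesP[g Ng ->]|[p [u [/PhiP[g Pg ->] [/UP[ks ->] ->]]]]]; last first.
  apply/normalizesP; exists (g * delta (transl ks)) => //.
  by rewrite gpredM ?norm_delta ?transl_norm // phi_norm.
have [ks [h [Ph ->]]] := norm_in_Uphi Ng.
(* The decomposition found has its U-factor on the left; conjugating the Phi-factor by it swaps the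
   order. *)
exists (aut_fun (h ^ (delta (transl ks))^-1)), (aut_fun (delta (transl ks))).
split.
  apply/PhiP; exists (h ^ (delta (transl ks))^-1) => //.
  by rewrite normJ // gpredV norm_delta ?transl_norm.
split; first by apply/UP; exists ks.
by rewrite aut_tmul -conjgCV.
Qed.
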